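(* Let $n\ge 2$, let $P=(p_1,\dots,p_n)$, $Q=(q_1,\dots,q_n)\in\Gamma_n$, and let $r,R$ be real numbers with $0<r\le \frac{p_i}{q_i}\le R<\infty$ for all $i\in\{1,\dots,n\}$. Then for every real $s\le \frac34$, $$\frac{r^{2-s}(r+3)}{(r+1)^2}\,\Phi_s(P\|Q)\ \le\ D(P\|Q)\ \le\ \frac{R^{2-s}(R+3)}{(R+1)^2}\,\Phi_s(P\|Q),$$ and for every real $s\ge 2$, $$\frac{R^{2-s}(R+3)}{(R+1)^2}\,\Phi_s(P\|Q)\ \le\ D(P\|Q)\ \le\ \frac{r^{2-s}(r+3)}{(r+1)^2}\,\Phi_s(P\|Q).$$
   Context: For $n\ge2$, $\Gamma_n=\{P=(p_1,\dots,p_n): p_i>0,\ \sum_{i=1}^n p_i=1\}$. For $P,Q\in\Gamma_n$ and $s\in\mathbb{R}$, the relative information of type $s$ is $\Phi_s(P\|Q)=[s(s-1)]^{-1}\left[\sum_{i=1}^n p_i^s q_i^{1-s}-1\right]$ for $s\ne 0,1$; $\Phi_0(P\|Q)=\sum_{i=1}^n q_i\ln\frac{q_i}{p_i}$; $\Phi_1(P\|Q)=\sum_{i=1}^n p_i\ln\frac{p_i}{q_i}$. The relative J-divergence is $D(P\|Q)=\sum_{i=1}^n (p_i-q_i)\ln\left(\frac{p_i+q_i}{2q_i}\right)$. *)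

(* Defs.v *)
From mathcomp Require Import all_boot all_order all_algebra.
From mathcomp Require Import all_classical all_reals all_analysis.
Set Implicit Arguments.
Unset Strict Implicit.
Unset Printing Implicit Defensive.
Import Order.TTheory GRing.Theory Num.Theory.
Local Open Scope ring_scope.

Definition Gamma (R : realType) (n : nat) : set ('I_n -> R) :=
  [set p | (forall i, 0 < p i) /\ \sum_(i < n) p i = 1]%classic.

(* On Gamma all arguments of ln and bases of powR are positive, so the junk
   values of these total functions never occur. *)
Definition Phi (R : realType) (n : nat) (s : R) (p q : 'I_n -> R) : R :=
  if s == 0 then \sum_(i < n) q i * ln (q i / p i)
  else if s == 1 then \sum_(i < n) p i * ln (p i / q i)
  else (s * (s - 1))^-1 * ((\sum_(i < n) p i `^ s * q i `^ (1 - s)) - 1).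

Definition rel_J_div (R : realType) (n : nat) (p q : 'I_n -> R) : R :=
  \sum_(i < n) (p i - q i) * ln ((p i + q i) / (2 * q i)).

(* Main.v *)
Require Import Defs.
From mathcomp Require Import all_boot all_order all_algebra.
From mathcomp Require Import all_classical all_reals all_analysis.
From mathcomp Require Import ring lra.
Set Implicit Arguments.
Unset Strict Implicit.
Unset Printing Implicit Defensive.
Import Order.TTheory GRing.Theory Num.Theory.
Import numFieldNormedType.Exports.
Local Open Scope ring_scope.

(** Both divergences are Csiszar sums [\sum_i q_i f (p_i / q_i)].  Adding a
    multiple of [x - 1] to [f] does not change such a sum when [p] and [q] have
    the same mass, so the generators can be normalised to vanish to second
    order at 1 ; they are then determined by their second derivative.  That
    derivative [f2] is the only datum on which comparisons depend.

    The normalised generators are [J_kernel x = (x - 1) ln ((x + 1) / 2)] for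
    the relative J-divergence, with second derivative [(x + 3) / (x + 1)^2],
    and [Phi_kernel s] for the relative information of type [s], with second
    derivative [x^(s - 2)] for every real [s], the values 0 and 1 included.
    The quotient of these second derivatives is
    [curvature_ratio (2 - s) x = x^(2 - s) (x + 3) / (x + 1)^2], which is the
    constant of the theorem evaluated at [r1] or [r2].

    If this quotient lies in [[m, M]] on [[r1, r2]], then
    [J_kernel - m Phi_kernel] and [M Phi_kernel - J_kernel] are convex there
    and vanish to second order at 1.  The point 1 belongs to [[r1, r2]], because
    the ratios [p_i / q_i] have [q]-mean 1 ([ratio_range1]), so these two
    functions are nonnegative on [[r1, r2]] ([kernel_le]) ; averaging against [q]
    gives the two inequalities ([Phi_rel_J_div_bounds]).

    It remains to see that the extreme values of the quotient are taken at the
    end points.  With [a = 2 - s], the logarithmic derivative of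
    [x^a (x + 3) / (x + 1)^2] has the sign of
    [(a - 1) x^2 + (4 a - 5) x + 3 a].  All three coefficients are nonnegative
    when [a >= 5/4], that is [s <= 3/4], and nonpositive when [a <= 0], that is
    [s >= 2] ; these are exactly the two ranges of [s] in the theorem. *)

(** * Normalised generators and their comparison *)

Definition csiszar_kernel (R : realType) (f f1 f2 : R -> R) :=
  [/\ f 1 = 0, f1 1 = 0, forall x : R, 0 < x -> is_derive x 1 f (f1 x)
   & forall x : R, 0 < x -> is_derive x 1 f1 (f2 x)].

(** The mean value theorem without an assumption on the order of [x] and [y] :
    [0 <= (c - x) * (y - x)] records that [c] lies on the same side of [x] as
    [y], which is all that the second-order argument below needs. *)
Lemma mvt_between (R : realType) (f df : R -> R) (a b x y : R) :
  0 < a -> (forall z : R, 0 < z -> is_derive z 1 f (df z)) ->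
  a <= x <= b -> a <= y <= b ->
  exists c, [/\ a <= c <= b, 0 <= (c - x) * (y - x)
    & f y - f x = df c * (y - x)].
Proof.
move=> a0 fdf.
have within_cont (u v : R) : a <= u -> {within `[u, v], continuous f}%classic.
  move=> au; apply: derivable_within_continuous => z.
  rewrite in_itv/= => /andP[uz _].
  by have [] := fdf z (lt_le_trans a0 (le_trans au uz)).
have itv_deriv (u v z : R) : a <= u -> z \in `]u, v[ -> is_derive z 1 f (df z).
  move=> au; rewrite in_itv/= => /andP[uz _].
  exact: fdf (lt_trans a0 (le_lt_trans au uz)).
move=> /andP[ax xb] /andP[ay yb].
have [xy|/ltW yx] := leP x y.
- have [c] := MVT_segment xy (fun z => @itv_deriv x y z ax) (within_cont x y ax).
  rewrite in_itv/= => /andP[xc cy] fE; exists c; split => //; last nra.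
  by rewrite (le_trans ax xc) (le_trans cy yb).
- have [c] := MVT_segment yx (fun z => @itv_deriv y x z ay) (within_cont y x ay).
  rewrite in_itv/= => /andP[yc cx] fE; exists c; split; [|nra|lra].
  by rewrite (le_trans ay yc) (le_trans cx xb).
Qed.

(** Two applications of the mean value theorem to [h = g - f] give
    [h x = h'' d (c - 1) (x - 1)] with [c] between 1 and [x], so that the sign
    of [h] is that of [h''].  This is where [1] has to belong to [[a, b]] :
    otherwise [d] could leave the interval on which [f2 <= g2]. *)
Lemma kernel_le (R : realType) (f f1 f2 g g1 g2 : R -> R) (a b : R) :
  csiszar_kernel f f1 f2 -> csiszar_kernel g g1 g2 ->
  0 < a -> a <= 1 <= b -> (forall x, a <= x <= b -> f2 x <= g2 x) ->
  forall x, a <= x <= b -> f x <= g x.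
Proof.
move=> [f0 f10 df df1] [g0 g10 dg dg1] a0 a1b fg2 x axb.
have dh (z : R) : 0 < z -> is_derive z 1 (g - f) (g1 z - f1 z).
  by move=> z0; apply: is_deriveB; [exact: dg|exact: df].
have dh1 (z : R) : 0 < z -> is_derive z 1 (g1 - f1) (g2 z - f2 z).
  by move=> z0; apply: is_deriveB; [exact: dg1|exact: df1].
have [c [acb cx hx]] := mvt_between a0 dh a1b axb.
have [d [adb _ h1c]] := mvt_between a0 dh1 a1b acb.
move: hx h1c; rewrite !fctE f0 g0 f10 g10 !subr0 => hx h1c.
by rewrite -subr_ge0 hx h1c -mulrA mulr_ge0// subr_ge0 fg2.
Qed.

Lemma kernelZ (R : realType) (f f1 f2 : R -> R) (c : R) :
  csiszar_kernel f f1 f2 ->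
  csiszar_kernel (fun x => c * f x) (fun x => c * f1 x) (fun x => c * f2 x).
Proof.
move=> [f0 f10 df df1]; split => [||x x0|x x0]; rewrite ?f0 ?f10 ?mulr0//.
- by have dfx := df x x0; exact: is_deriveZ.
- by have dfx := df1 x x0; exact: is_deriveZ.
Qed.

Lemma is_derive_ln_affine (R : realType) (c k x : R) :
  0 < c -> 0 < x + k -> is_derive x 1 (fun y => ln ((y + k) / c)) (x + k)^-1.
Proof.
move=> c0 xk.
have d1 : is_derive x 1 (fun y : R => (y + k) / c) c^-1.
  rewrite (_ : (fun y => _) = (c^-1 \*: (id + cst k)))%R; last first.
    by apply/funext => y; rewrite !fctE/= mulrC.
  by apply: is_derive_eq; rewrite addr0 /GRing.scale/= mulr1.
have d2 : is_derive ((x + k) / c) 1 (@ln R) ((x + k) / c)^-1.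
  by apply: is_derive1_ln; rewrite divr_gt0.
rewrite (_ : (fun y => ln _) = @ln R \o (fun y => (y + k) / c))//.
have dc := @is_derive1_comp R (@ln R) (fun y => (y + k) / c) x _ _ d2 d1.
apply: (is_derive_eq dc).
by field; rewrite !gt_eqF.
Qed.

(** * The generators of the two divergences *)

Definition J_kernel (R : realType) (x : R) : R := (x - 1) * ln ((x + 1) / 2).

Lemma is_derive_addc_inv (R : realType) (k x : R) :
  0 < x + k -> is_derive x 1 (fun y : R => (y + k)^-1) (- (x + k) ^- 2).
Proof.
move=> xk.
have d1 : is_derive x 1 (fun y : R => y + k) 1.
  by apply: is_derive_eq; rewrite addr0.
have xk0 : x + k != 0 by rewrite gt_eqF.
have [dd De] := d1; split; first exact: derivableV.
by rewrite deriveV// De /GRing.scale/= mulr1.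
Qed.

Lemma J_kernelP (R : realType) :
  csiszar_kernel (@J_kernel R) (fun x => ln ((x + 1) / 2) + (1 - 2 * (x + 1)^-1))
    (fun x => (x + 3) / (x + 1) ^+ 2).
Proof.
have dln (x : R) : 0 < x ->
    is_derive x 1 (fun y : R => ln ((y + 1) / 2)) (x + 1)^-1.
  by move=> x0; apply: is_derive_ln_affine; lra.
have half : (1 + 1) / 2 = 1 :> R by lra.
split => [|||].
- by rewrite /J_kernel subrr mul0r.
- by rewrite half ln1; lra.
- move=> x x0; have dlnx := dln x x0.
  rewrite (_ : @J_kernel R = (id - cst 1) * (fun y => ln ((y + 1) / 2)))//.
  apply: is_derive_eq; rewrite /GRing.scale/= !fctE/=; field; lra.
- move=> x x0; have dlnx := dln x x0.
  have dinv : is_derive x 1 (fun y : R => (y + 1)^-1) (- (x + 1) ^- 2).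
    by apply: is_derive_addc_inv; lra.
  rewrite (_ : (fun x => _) = (fun y : R => ln ((y + 1) / 2)) +
    (cst 1 - 2 \*: (fun y : R => (y + 1)^-1)))//.
  apply: is_derive_eq; rewrite /GRing.scale/=; field; lra.
Qed.

(** The linear terms make the function vanish to second order at 1.  The cases
    0 and 1 are the limits of the general formula. *)
Definition Phi_kernel (R : realType) (s x : R) : R :=
  if s == 0 then x - 1 - ln x
  else if s == 1 then x * ln x - (x - 1)
  else (s * (s - 1))^-1 * (x `^ s - 1 - s * (x - 1)).

(** At [s = 0] the general formula gives [1 - x^-1], which is indeed the
    derivative of [x - 1 - ln x]. *)
Definition dPhi_kernel (R : realType) (s x : R) : R :=
  if s == 1 then ln x else (s - 1)^-1 * (x `^ (s - 1) - 1).

Lemma Phi_kernelP (R : realType) (s : R) :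
  csiszar_kernel (Phi_kernel s) (dPhi_kernel s) (fun x => x `^ (s - 2)).
Proof.
split => [||x x0|x x0].
- rewrite /Phi_kernel powR1 ln1; case: ifP => _; first by lra.
  by case: ifP => _; lra.
- by rewrite /dPhi_kernel powR1 ln1 subrr mulr0 if_same.
- have dln := is_derive1_ln x0; have dpow := is_derive1_powR s x0.
  rewrite /dPhi_kernel; have [s0|s0] := eqVneq s 0.
    rewrite s0 (_ : Phi_kernel 0 = (id - cst 1) - @ln R); last first.
      by apply/funext => y; rewrite /Phi_kernel eqxx.
    apply: is_derive_eq; rewrite eq_sym oner_eq0 sub0r powR_inv1 ?ltW//.
    by field; rewrite gt_eqF.
  have [s1|s1] := eqVneq s 1.
    rewrite s1 (_ : Phi_kernel 1 = id * @ln R - (id - cst 1)); last first.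
      by apply/funext => y; rewrite /Phi_kernel oner_eq0 eqxx.
    by apply: is_derive_eq; rewrite /GRing.scale/=; field; rewrite gt_eqF.
  rewrite (_ : Phi_kernel s = (s * (s - 1))^-1 \*:
    ((@powR R ^~ s) - cst 1 - s \*: (id - cst 1))); last first.
    by apply/funext => y; rewrite /Phi_kernel (negbTE s0) (negbTE s1).
  apply: is_derive_eq; rewrite /GRing.scale/=.
  by field; rewrite subr_eq0 s0 s1.
- have dln := is_derive1_ln x0; have dpow := is_derive1_powR (s - 1) x0.
  have [s1|s1] := eqVneq s 1.
    rewrite s1 (_ : dPhi_kernel 1 = @ln R); last first.
      by apply/funext => y; rewrite /dPhi_kernel eqxx.
    by rewrite (_ : 1 - 2 = - 1) ?powR_inv1 ?ltW//; lra.
  rewrite (_ : dPhi_kernel s =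
    (s - 1)^-1 \*: ((@powR R ^~ (s - 1)) - cst 1)); last first.
    by apply/funext => y; rewrite /dPhi_kernel (negbTE s1).
  apply: is_derive_eq; rewrite /GRing.scale/= (_ : s - 1 - 1 = s - 2); last lra.
  by field; rewrite subr_eq0.
Qed.

(** * Monotonicity of the quotient of second derivatives *)

Definition curvature_ratio (R : realType) (a x : R) : R :=
  x `^ a * (x + 3) / (x + 1) ^+ 2.

(** Taking logarithms turns the derivative into a rational function. *)
Definition ln_curvature_ratio (R : realType) (a x : R) : R :=
  a * ln x + ln (x + 3) - 2 * ln (x + 1).

Lemma curvature_ratioE (R : realType) (a x : R) :
  0 < x -> curvature_ratio a x = expR (ln_curvature_ratio a x).
Proof.
move=> x0; rewrite /curvature_ratio /ln_curvature_ratio expRB expRD /powR gt_eqF//.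
rewrite lnK ?posrE; last lra.
by rewrite mulr_natl -lnXn ?lnK// ?posrE ?exprn_gt0//; lra.
Qed.

Lemma is_derive_ln_curvature_ratio (R : realType) (a x : R) : 0 < x ->
  is_derive x 1 (ln_curvature_ratio a) (((a - 1) * x ^+ 2 + (4 * a - 5) * x + 3 * a)
    / (x * (x + 1) * (x + 3))).
Proof.
move=> x0; have d0 := is_derive1_ln x0.
have d (k : R) : 0 < k -> is_derive x 1 (fun y : R => ln (y + k)) (x + k)^-1.
  move=> k0; rewrite (_ : (fun y => _) = fun y : R => ln ((y + k) / 1)).
    by apply: is_derive_ln_affine; lra.
  by apply/funext => y; rewrite divr1.
have d1 : is_derive x 1 (fun y : R => ln (y + 1)) (x + 1)^-1 by exact: d.
have d3 : is_derive x 1 (fun y : R => ln (y + 3)) (x + 3)^-1 by apply: d; lra.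
rewrite (_ : ln_curvature_ratio a = a \*: @ln R + (fun y => ln (y + 3)) -
  2 \*: (fun y => ln (y + 1)))//.
apply: is_derive_eq; rewrite /GRing.scale/=.
by field; rewrite !gt_eqF//; lra.
Qed.

(** The threshold [5 / 4] comes from the middle coefficient [4 a - 5] of the
    numerator in [is_derive_ln_curvature_ratio]. *)
Lemma curvature_ratio_nondecreasing (R : realType) (a x y : R) :
  5 / 4 <= a -> 0 < x -> x <= y -> curvature_ratio a x <= curvature_ratio a y.
Proof.
move=> a54 x0 xy; have y0 := lt_le_trans x0 xy.
rewrite !curvature_ratioE// ler_expR -subr_ge0.
have [||c [/andP[xc cy] _ ->]] := @mvt_between _ (ln_curvature_ratio a) _ x y x y x0
  (fun z => @is_derive_ln_curvature_ratio R a z); rewrite ?lexx ?xy//.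
have c0 := lt_le_trans x0 xc.
rewrite mulr_ge0 ?subr_ge0// divr_ge0//; first by nra.
by rewrite !mulr_ge0//; lra.
Qed.

Lemma curvature_ratio_nonincreasing (R : realType) (a x y : R) :
  a <= 0 -> 0 < x -> x <= y -> curvature_ratio a y <= curvature_ratio a x.
Proof.
move=> a0 x0 xy; have y0 := lt_le_trans x0 xy.
rewrite !curvature_ratioE// ler_expR -subr_le0.
have [||c [/andP[xc cy] _ ->]] := @mvt_between _ (ln_curvature_ratio a) _ x y x y x0
  (fun z => @is_derive_ln_curvature_ratio R a z); rewrite ?lexx ?xy//.
have c0 := lt_le_trans x0 xc.
rewrite mulr_le0_ge0 ?subr_ge0// mulr_le0_ge0//; first by nra.
by rewrite invr_ge0 !mulr_ge0//; lra.
Qed.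

(** * From generators to divergences *)

Lemma rel_J_divE (R : realType) (n : nat) (p q : 'I_n -> R) :
  (forall i, 0 < q i) ->
  rel_J_div p q = \sum_(i < n) q i * J_kernel (p i / q i).
Proof.
move=> q0; apply: eq_bigr => i _; have qi := lt0r_neq0 (q0 i).
rewrite /J_kernel mulrA; congr (_ * ln _); first by field.
by field.
Qed.

(** The linear part of [Phi_kernel] disappears in the sum because
    [\sum_i (p_i - q_i) = 0]. *)
Lemma PhiE (R : realType) (n : nat) (s : R) (p q : 'I_n -> R) :
  Gamma p -> Gamma q -> Phi s p q = \sum_(i < n) q i * Phi_kernel s (p i / q i).
Proof.
move=> [p0 sp] [q0 sq].
have add_lin (c S : R) : S = \sum_(i < n) c * (p i - q i) + S.
  by rewrite -mulr_sumr sumrB sp sq subrr mulr0 add0r.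
have qn0 i : q i != 0 by rewrite gt_eqF.
rewrite /Phi /Phi_kernel; case: ifP => [s0|s0].
  (* The coefficients given to [add_lin] are those of [x - 1] in the three
     formulas for [Phi_kernel], up to the factor [(s * (s - 1))^-1] in the
     last one. *)
  rewrite [LHS](add_lin 1) -big_split/=; apply: eq_bigr => i _.
  by rewrite -[q i / p i]invf_div lnV ?posrE ?divr_gt0//; field.
case: ifP => [s1|s1].
  rewrite [LHS](add_lin (-1)) -big_split/=; apply: eq_bigr => i _.
  by field.
under [RHS]eq_bigr do rewrite mulrCA.
rewrite -mulr_sumr; congr (_ * _).
rewrite -[X in _ - X = _]sq -sumrB [LHS](add_lin (- s)) -big_split/=.
apply: eq_bigr => i _.
have -> : p i `^ s * q i `^ (1 - s) = q i * (p i / q i) `^ s.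
  rewrite powRM ?invr_ge0 ?ltW// -powR_inv1 ?ltW// -powRrM mulN1r.
  rewrite powRD ?qn0 ?implybT// powRr1 ?ltW//; ring.
by field.
Qed.

(** The mean of [p_i / q_i] with weights [q_i] is [\sum_i p_i = 1]. *)
Lemma ratio_range1 (R : realType) (n : nat) (p q : 'I_n -> R) (r1 r2 : R) :
  Gamma p -> Gamma q -> (forall i, r1 <= p i / q i <= r2) -> r1 <= 1 <= r2.
Proof.
move=> [p0 sp] [q0 sq] hpq.
have : r1 * \sum_(i < n) q i <= \sum_(i < n) p i <= r2 * \sum_(i < n) q i.
  rewrite !mulr_sumr; apply/andP; split; apply: ler_sum => i _.
  - by rewrite -ler_pdivlMr//; have /andP[] := hpq i.
  - by rewrite -ler_pdivrMr//; have /andP[] := hpq i.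
by rewrite sp sq !mulr1.
Qed.

(** The second derivative of [J_kernel] is [curvature_ratio (2 - s)] times that
    of [Phi_kernel s], so bounds on this factor are exactly the hypotheses
    of [kernel_le] for [J_kernel] and a multiple of [Phi_kernel s]. *)
Lemma Phi_rel_J_div_bounds (R : realType) (n : nat) (p q : 'I_n -> R)
    (s r1 r2 m M : R) : Gamma p -> Gamma q -> 0 < r1 ->
  (forall i, r1 <= p i / q i <= r2) ->
  (forall x, r1 <= x <= r2 -> m <= curvature_ratio (2 - s) x <= M) ->
  m * Phi s p q <= rel_J_div p q /\ rel_J_div p q <= M * Phi s p q.
Proof.
move=> Gp Gq r0 hpq mM.
have r1r2 := ratio_range1 Gp Gq hpq; have [q0 _] := Gq.
have J2 (x : R) : r1 <= x ->
    (x + 3) / (x + 1) ^+ 2 = curvature_ratio (2 - s) x * x `^ (s - 2).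
  move=> /(lt_le_trans r0) x0; rewrite /curvature_ratio.
  rewrite -[s - 2]opprB powRN; field.
  by rewrite !gt_eqF ?powR_gt0//; lra.
have phik c := kernelZ c (Phi_kernelP s).
rewrite PhiE// rel_J_divE// !mulr_sumr; split; apply: ler_sum => i _.
- rewrite mulrCA ler_pM2l//.
  apply: (kernel_le (phik m) (@J_kernelP R) r0 r1r2 _ (hpq i)) => x xr.
  have /andP[rx _] := xr; have /andP[mx _] := mM x xr.
  by rewrite J2// ler_wpM2r// powR_ge0.
- rewrite [leRHS]mulrCA ler_pM2l//.
  apply: (kernel_le (@J_kernelP R) (phik M) r0 r1r2 _ (hpq i)) => x xr.
  have /andP[rx _] := xr; have /andP[_ mx] := mM x xr.
  by rewrite J2// ler_wpM2r// powR_ge0.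
Qed.

Theorem theorem4p1 (R : realType) (n : nat) (hn : (2 <= n)%N)
    (p q : 'I_n -> R) (hp : Gamma p) (hq : Gamma q)
    (r1 r2 : R) (hr1 : 0 < r1)
    (hpq : forall i : 'I_n, r1 <= p i / q i /\ p i / q i <= r2) :
  (forall s : R, s <= 3 / 4 ->
     r1 `^ (2 - s) * (r1 + 3) / (r1 + 1) ^+ 2 * Phi s p q <= rel_J_div p q /\
     rel_J_div p q <= r2 `^ (2 - s) * (r2 + 3) / (r2 + 1) ^+ 2 * Phi s p q) /\
  (forall s : R, 2 <= s ->
     r2 `^ (2 - s) * (r2 + 3) / (r2 + 1) ^+ 2 * Phi s p q <= rel_J_div p q /\
     rel_J_div p q <= r1 `^ (2 - s) * (r1 + 3) / (r1 + 1) ^+ 2 * Phi s p q).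
Proof.
have range i : r1 <= p i / q i <= r2 by apply/andP.
split => s hs; apply: (Phi_rel_J_div_bounds hp hq hr1 range) => x /andP[rx xr];
  have x0 := lt_le_trans hr1 rx; apply/andP.
- by split; apply: curvature_ratio_nondecreasing => //; lra.
- by split; apply: curvature_ratio_nonincreasing => //; lra.
Qed.
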